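(* Let $q=p^t$ be a power of an odd prime $p$, $t\geq1$, let $m\geq3$ be an integer (with $m\geq4$ if $q=3$), and let $n=q^m-1$. Then there exist asymmetric quantum codes with parameters (1) $[[tn,\ t(n-m(4q-5)-2),\ d_z\geq 2q+2\,/\,d_x\geq 2q]]_p$; (2) $[[tn,\ t(n-m(4q-c-5)-2),\ d_z\geq 2q+2\,/\,d_x\geq 2q-c]]_p$, for $0\leq c\leq q-2$; (3) $[[tn,\ t(n-m(2c-l-4)-2),\ d_z\geq c\,/\,d_x\geq c-l]]_p$, for $2\leq c\leq q$ and $0\leq l\leq c-2$; (4) $[[tn,\ t(n-m(2c-l-6)-2),\ d_z\geq c\,/\,d_x\geq c-l]]_p$, for $q+2<c\leq 2q$ and $0\leq l\leq c-q-3$; (5) $[[tn,\ t(n-m(4q-l-5)-1),\ d_z\geq 2q+1\,/\,d_x\geq 2q-l]]_p$, for $0\leq l\leq q-2$.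
   Context: An AQECC $[[n,k,d_z/d_x]]_p$ is a $p^k$-dimensional subspace of $\mathbb{C}^{p^n}$ correcting all qudit-flip errors up to $\lfloor (d_x-1)/2\rfloor$ and all phase-shift errors up to $\lfloor (d_z-1)/2\rfloor$; the notation $d_z\geq a/d_x\geq b$ means the code has such distances with $d_z\geq a$ and $d_x\geq b$. *)

(* Defs.v *)
(* Complex numbers are modelled by algC (algebraic complex numbers). *)
From HB Require Import structures.
From mathcomp Require Import all_boot all_order all_algebra.
From mathcomp Require Import algC.
Set Implicit Arguments. Unset Strict Implicit. Unset Printing Implicit Defensive.
Import Order.TTheory GRing.Theory Num.Theory.
Local Open Scope ring_scope.

(* Computational basis labels of N qudits of dimension p: x in F_p^N. *)
Definition qlabel (p N : nat) := {ffun 'I_N -> 'F_p}.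

(* The Hilbert space C^(p^N), as functions from basis labels to C. *)
Definition hspace (p N : nat) := {ffun qlabel p N -> algC^o}.

Definition hdot (p N : nat) (u v : hspace p N) : algC :=
  \sum_(x : qlabel p N) (u x)^* * v x.

Definition wt (p N : nat) (a : qlabel p N) : nat := #|[set i | a i != 0]|.

(* Qudit-flip error X(a): |x> |-> |x + a>. *)
Definition Xerr (p N : nat) (a : qlabel p N) (u : hspace p N) : hspace p N :=
  [ffun x : qlabel p N => u (x - a)].

(* Phase-shift error Z(b): |x> |-> w^(b.x) |x>, w a primitive p-th root of 1. *)
Definition Zerr (p N : nat) (w : algC) (b : qlabel p N) (u : hspace p N)
  : hspace p N :=
  [ffun x : qlabel p N => w ^+ (nat_of_ord (\sum_i b i * x i)) * u x].

(* Q corrects every combination of qudit-flip errors of weight <= tx and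
   phase-shift errors of weight <= tz (Knill--Laflamme conditions). *)
Definition corrects (p N : nat) (Q : {vspace hspace p N}) (tz tx : nat) : Prop :=
  forall w : algC, p.-primitive_root w ->
  forall a1 b1 a2 b2 : qlabel p N,
    (wt a1 <= tx)%N -> (wt a2 <= tx)%N -> (wt b1 <= tz)%N -> (wt b2 <= tz)%N ->
    exists c : algC, forall u v : hspace p N, u \in Q -> v \in Q ->
      hdot (Xerr a1 (Zerr w b1 u)) (Xerr a2 (Zerr w b2 v)) = c * hdot u v.

(* An asymmetric quantum code [[N, k, dz >= az / dx >= ax]]_p: a p^k-dimensional
   subspace of C^(p^N) correcting all qudit-flip errors up to floor((ax-1)/2)
   and all phase-shift errors up to floor((az-1)/2). *)
Definition AQECC (p N k az ax : nat) : Prop :=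
  exists Q : {vspace hspace p N},
    \dim Q = (p ^ k)%N /\ corrects Q (az.-1)./2 (ax.-1)./2.

(* Main.v *)
(* CSS construction from nested BCH codes of length n = q^m - 1 over F_q,
   expanded to F_p. Correcting floor((d - 1) / 2) errors only requires that no
   nonzero word of weight <= 2 floor((d - 1) / 2) lies in the relevant
   classical code, so an even d needs only d - 2 consecutive zeros, which can
   be taken to be 1, ..., d - 2. When both distances are odd, each side needs an
   exponent with a one-element cyclotomic coset; one code uses 0 and the other
   n / 2, which amounts to twisting the second syndromes by (-1)^j.

   C1 is the kernel of syndromes S_k(a) = sum_j a_j eps^j alpha^(k j), and C2
   consists of the words j |-> sum_i Tr(y_i alpha^(i j)); the expansions of
   F_q-symbols used for the two codes are dual to each other, so that a word
   orthogonal to C2 has zero syndromes at the exponents i. The inclusion of C2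
   in C1 is the vanishing of geometric sums, i.e. eps alpha^(k + i q^s) != 1,
   which holds because k and i are at most 2 q: k + i q^s = M n forces q^s to
   divide the small number k + M (with k and i doubled in the twisted case). *)
From HB Require Import structures.
Require Import Defs.
From mathcomp Require Import all_boot all_order all_algebra.
From mathcomp Require Import algC cyclic all_field zify.
Set Implicit Arguments.
Unset Strict Implicit.
Unset Printing Implicit Defensive.
Import Order.TTheory GRing.Theory Num.Theory.
Local Open Scope ring_scope.

(** Plays the role of the index formula for a homomorphism. It bounds from below the number of
    cosets of [C2] in [C1], and later the size of a syndrome kernel. *)
Lemma card_leq_fibers (T U : finType) (f : T -> U) (A : {set T}) (M : nat) :
  (forall y, y \in f @: A -> #|[set x in A | f x == y]| <= M)%N ->
  (#|A| <= #|f @: A| * M)%N.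
Proof.
move=> hM; rewrite -sum1_card (partition_big_imset f) /= -sum_nat_const.
apply: leq_sum => y /hM; rewrite -sum1_card; congr (_ <= _)%N.
by apply: eq_bigl => x; rewrite inE.
Qed.

(** * Additive characters of ['F_p] *)

Section Characters.
Variables (p : nat) (w : algC).
Hypotheses (p_pr : prime p) (w_prim : p.-primitive_root w).

Lemma prim_expr_FpD (x y : 'F_p) : w ^+ (x + y : 'F_p)%R = w ^+ x * w ^+ y.
Proof.
by rewrite -exprD /= [X in (_ %% X)%N]Fp_cast // (prim_expr_mod w_prim).
Qed.

Lemma prim_expr_Fp_eq1 (x : 'F_p) : (w ^+ x == 1) = (x == 0).
Proof.
rewrite -(prim_order_dvd w_prim) -val_eqE /=.
have xlt : (x < p)%N by rewrite -[X in (_ < X)%N](Fp_cast p_pr) ltn_ord.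
apply/idP/eqP => [|->]; last exact: dvdn0.
by case: (posnP x) => // x0 /(dvdn_leq x0); rewrite leqNgt xlt.
Qed.

Lemma conj_prim_expr_Fp (x : 'F_p) : (w ^+ x)^* = w ^+ (- x : 'F_p)%R.
Proof.
have nw : `|w ^+ x| = 1.
  apply/eqP; rewrite -(@pexpr_eq1 _ _ p) ?normr_ge0 ?prime_gt0 //.
  by rewrite -normrX -exprM mulnC exprM (prim_expr_order w_prim) expr1n normr1.
apply: (mulfI (x := w ^+ x)); first by rewrite -normr_eq0 nw oner_eq0.
by rewrite -prim_expr_FpD subrr -normCK nw expr1n expr0.
Qed.

End Characters.

(** * The CSS construction with coset states *)

Section CosetStates.
Variables (p N k : nat) (C1 C2 : {set qlabel p N}).
Hypotheses (p_pr : prime p).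
Hypotheses (C1_sub : {in C1 &, forall x y : qlabel p N, x - y \in C1}).
Hypotheses (C2_0 : 0 \in C2) (C2_sub : {in C2 &, forall x y : qlabel p N, x - y \in C2}).
Hypotheses (C21 : C2 \subset C1) (card_C12 : (#|C2| * p ^ k <= #|C1|)%N).

Let coset (x : qlabel p N) : {set qlabel p N} := [set x + y | y in C2].
Let cosets : {set {set qlabel p N}} := coset @: C1.
Let state (A : {set qlabel p N}) : hspace p N :=
  [ffun x => (x \in A)%:R].
(** Unnormalised CSS basis states: the Knill-Laflamme condition is homogeneous, so norms do not
    matter. Keeping [p ^ k] cosets makes the dimension exact although only a lower bound on the
    index is assumed. *)
Let states : seq (hspace p N) :=
  [seq state A | A <- take (p ^ k) (enum cosets)].

Let mem_coset x y : (y \in coset x) = (y - x \in C2).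
Proof.
apply/imsetP/idP => [[z zC ->]|yx]; first by rewrite addrC addKr.
by exists (y - x) => //; rewrite addrC subrK.
Qed.

Let C2N y : y \in C2 -> - y \in C2.
Proof. by move=> yC; rewrite -sub0r C2_sub. Qed.

Let C2D y z : y \in C2 -> z \in C2 -> y + z \in C2.
Proof. by move=> yC zC; rewrite -[z]opprK C2_sub ?C2N. Qed.

Let coset_addr x y z : z \in C2 -> (y + z \in coset x) = (y \in coset x).
Proof.
move=> zC; rewrite !mem_coset; apply/idP/idP => h.
  have -> : y - x = y + z - x - z by rewrite addrAC addrK.
  by rewrite C2_sub.
by rewrite addrAC C2D.
Qed.

Let coset_eq x y : y \in coset x -> coset x = coset y.
Proof.
rewrite mem_coset => yx; apply/setP=> z; rewrite !mem_coset.
have -> : z - x = (z - y) + (y - x) by rewrite addrA subrK.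
apply/idP/idP => [zx|]; last by move=> zy; apply: C2D.
by rewrite -[z - y](addrK (y - x)) C2_sub.
Qed.

Let size_states : size states = (p ^ k)%N.
Proof.
rewrite size_map size_takel // -cardE.
have C2gt0 : (0 < #|C2|)%N by apply/card_gt0P; exists 0.
rewrite -(leq_pmul2l C2gt0); apply: (leq_trans card_C12).
rewrite [X in (_ <= X)%N]mulnC; apply: card_leq_fibers => _ /imsetP[x xC ->].
apply: (@leq_trans #|coset x|); last exact: leq_imset_card.
apply/subset_leq_card/subsetP => y; rewrite inE => /andP[_ /eqP <-].
by rewrite mem_coset subrr.
Qed.

(** Distinct cosets are disjoint, so evaluating a vanishing combination at a representative of the
    [i]-th coset isolates the [i]-th coefficient. *)
Let free_states : free states.
Proof.
have u_st : uniq (take (p ^ k) (enum cosets)) by rewrite take_uniq ?enum_uniq.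
have st_in A : A \in take (p ^ k) (enum cosets) -> exists2 x, x \in C1 & A = coset x.
  by move=> /mem_take; rewrite mem_enum => /imsetP[x]; exists x.
rewrite -[states]in_tupleE; apply/freeP => c.
have sz : size states = size (take (p ^ k) (enum cosets)) by rewrite size_map.
move=> c0 i; set B := nth set0 (take (p ^ k) (enum cosets)).
have nthB (j : 'I_(size states)) : (in_tuple states)`_j = state (B j).
  by rewrite (nth_map set0) // -sz ltn_ord.
have Bin (j : 'I_(size states)) : B j \in take (p ^ k) (enum cosets).
  by rewrite mem_nth // -sz ltn_ord.
have [x xC Bx] := st_in _ (Bin i).
move/ffunP: c0 => /(_ x); rewrite sum_ffunE !ffunE (bigD1 i) //= big1 ?addr0.
  rewrite nthB !ffunE Bx mem_coset subrr C2_0.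
  by rewrite /GRing.scale /= mulr1.
move=> j ji; rewrite nthB !ffunE.
have [y yC By] := st_in _ (Bin j).
case xB : (x \in B j); last by rewrite scaler0.
case/eqP: ji; apply/val_inj/eqP; rewrite -(nth_uniq set0 _ _ u_st) -?sz ?ltn_ord //.
by rewrite -/(B j) -/(B i) Bx By -(@coset_eq y x) -?By.
Qed.

(** Only these two properties of code vectors enter the error analysis. Both hold for coset
    indicators and survive linear combinations. *)
Let span_states u : u \in <<states>>%VS ->
  (forall x, x \notin C1 -> u x = 0) /\
  (forall x z, z \in C2 -> u (x + z) = u x).
Proof.
rewrite -[states]in_tupleE => /coord_span ->.
have stP (i : 'I_(size states)) :
    exists2 x, x \in C1 & (in_tuple states)`_i = state (coset x).
  have : states`_i \in states by rewrite mem_nth.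
  case/mapP=> A /mem_take; rewrite mem_enum => /imsetP[x xC ->] e.
  by exists x.
split=> [x xC|x z zC]; rewrite !sum_ffunE.
  apply: big1 => i _; have [y yC ->] := stP i; rewrite !ffunE.
  case xy : (x \in coset y); last by rewrite scaler0.
  case/negP: xC; rewrite -[x](subrK y) -[y in X in _ + X]opprK C1_sub //.
    by rewrite (subsetP C21) // -mem_coset.
  by rewrite -sub0r C1_sub // (subsetP C21).
apply: eq_bigr => i _; have [y yC ->] := stP i; rewrite !ffunE.
by rewrite coset_addr.
Qed.

(* If a1 <> a2, the two shifted supports are disjoint; otherwise translating
   the sum by a word z of C2 multiplies it by w^((b2 - b1).z), which differs
   from 1 for some z as soon as b1 <> b2. *)
Lemma AQECC_css (az ax : nat) :
  {in C1, forall a, (wt a <= (ax.-1)./2.*2)%N -> a = 0} ->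
  (forall b : qlabel p N, (wt b <= (az.-1)./2.*2)%N ->
     (forall z : qlabel p N, z \in C2 -> \sum_i b i * z i = 0) -> b = 0) ->
  AQECC p N k az ax.
Proof.
move=> dx dz; exists <<states>>%VS; split.
  by rewrite (eqnP free_states) size_states.
have wtB (a b : qlabel p N) : (wt (a - b)%R <= wt a + wt b)%N.
  apply: leq_trans (leq_card_setU _ _); apply/subset_leq_card/subsetP => i.
  rewrite !inE !ffunE; apply: contraR; rewrite negb_or !negbK.
  by move=> /andP[/eqP-> /eqP->]; rewrite subrr.
move=> w wP a1 b1 a2 b2 wa1 wa2 wb1 wb2.
have [a12|na12] := boolP (a1 - a2 \in C1); last first.
  exists 0 => u v /span_states[u0 _] /span_states[v0 _]; rewrite mul0r.
  apply: big1 => x _; rewrite !ffunE.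
  have [xa1|/u0->] := boolP (x - a1 \in C1); last by rewrite mulr0 conjC0 mul0r.
  rewrite [v _]v0 ?mulr0 //; apply: contra na12 => xa2.
  have -> : a1 - a2 = (x - a2) - (x - a1) by rewrite opprB [RHS]addrC addrA subrK.
  exact: C1_sub.
(* The difference of two correctable flips has weight at most twice the correction radius, which is
   the range of [dx]. *)
have {}a12 : a1 = a2.
  apply/eqP; rewrite -subr_eq0; apply/eqP/dx => //.
  by apply: leq_trans (wtB _ _) _; rewrite -addnn leq_add.
subst a2; pose b := b2 - b1.
pose dot (b x : qlabel p N) := \sum_i b i * x i.
have hdotE u v : hdot (Xerr a1 (Zerr w b1 u)) (Xerr a1 (Zerr w b2 v)) =
    \sum_x w ^+ (dot b x : 'F_p) * ((u x)^* * v x).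
  rewrite /hdot (reindex_inj (addIr a1)); apply: eq_bigr => x _.
  rewrite !ffunE addrK rmorphM /= (conj_prim_expr_Fp p_pr wP).
  rewrite mulrACA -(prim_expr_FpD p_pr wP); congr (w ^+ _ * _).
  rewrite addrC; congr (nat_of_ord _).
  by rewrite -sumrB; apply: eq_bigr => i _; rewrite !ffunE mulrBl.
have [b0|bn0] := eqVneq b 0.
  exists 1 => u v _ _; rewrite hdotE mul1r; apply: eq_bigr => x _.
  rewrite /dot big1 ?expr0 ?mul1r // => i _.
  by rewrite b0 ffunE mul0r.
have [/forall_inP all0|] := boolP [forall z in C2, dot b z == 0].
  case/eqP: bn0; apply: dz => [|z /all0/eqP //].
  by apply: leq_trans (wtB _ _) _; rewrite -addnn leq_add.
rewrite negb_forall => /existsP[z]; rewrite negb_imply => /andP[zC bz].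
exists 0 => u v /span_states[_ uz] /span_states[_ vz].
rewrite hdotE mul0r; set S := \sum_x _.
have : S = w ^+ (dot b z : 'F_p) * S.
  rewrite {1}/S (reindex_inj (addIr z)) /= mulr_sumr; apply: eq_bigr => x _.
  rewrite uz // vz // mulrA -(prim_expr_FpD p_pr wP); congr (w ^+ _ * _).
  congr (nat_of_ord _); rewrite addrC -big_split; apply: eq_bigr => i _.
  by rewrite !ffunE mulrDr.
move/eqP; rewrite -subr_eq0 -{1}[S]mul1r -mulrBl mulf_eq0 subr_eq0 eq_sym.
by rewrite (prim_expr_Fp_eq1 p_pr wP) (negPf bz) => /eqP.
Qed.

End CosetStates.

(** * The BCH bound and geometric sums *)

(** If [x j0] is nonzero, let [P] vanish at [z ^+ j] for all other support positions [j]. Its degree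
    is below [w], so pairing [x] with [P] uses only the [w] consecutive vanishing sums, yet leaves a
    nonzero term at [j0]. *)
Lemma bch_bound (F : fieldType) (n : nat) (z : F) (x : 'I_n -> F) (s w : nat) :
  n.-primitive_root z -> (#|[set j | (x j != 0)%R]| <= w)%N ->
  (forall i, (s <= i < s + w)%N -> \sum_j x j * z ^+ (i * j) = 0) ->
  forall j, x j = 0.
Proof.
move=> zP; set J := [set j | _] => Jw x0 j0; apply/eqP.
have [//|xj0] := boolP (x j0 == 0).
pose P : {poly F} := \prod_(j in J :\ j0) ('X - (z ^+ j)%:P).
have szP : (size P <= w)%N.
  rewrite /P -big_enum size_prod_XsubC -cardE; apply: leq_trans Jw.
  by rewrite (cardsD1 j0 J) inE xj0 add1n.
have : \sum_j x j * z ^+ (s * j) * P.[z ^+ j] = 0.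
  under eq_bigr do rewrite (horner_coef_wide _ szP) mulr_sumr.
  rewrite exchange_big big1 //= => i _.
  transitivity (P`_i * \sum_j x j * z ^+ ((s + i) * j)).
    rewrite mulr_sumr; apply: eq_bigr => j _.
    by rewrite mulnDl exprD [(i * j)%N]mulnC [z ^+ (j * i)]exprM [LHS]mulrCA -!mulrA.
  by rewrite x0 ?mulr0 // leq_addr ltn_add2l ltn_ord.
rewrite (bigD1 j0) //= big1 ?addr0 => [/eqP|j jj0].
  rewrite !mulf_eq0 (negPf xj0) expf_eq0.
  have -> : z == 0 = false.
    apply/eqP => z0; move: (prim_expr_order zP) (prim_order_gt0 zP).
    by rewrite z0 expr0n; case: (n) => // ? /eqP; rewrite eq_sym oner_eq0.
  rewrite andbF /= horner_prod => /prodf_eq0[j]; rewrite !inE => /andP[jj0 _].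
  rewrite !hornerE subr_eq0 (eq_prim_root_expr zP) !modn_small ?ltn_ord //.
  by rewrite eq_sym val_eqE (negPf jj0).
have [->|xj] := eqVneq (x j) 0; first by rewrite !mul0r.
rewrite horner_prod (bigD1 j) ?inE ?jj0 ?xj //=.
by rewrite hornerXsubC subrr mul0r mulr0.
Qed.

Lemma sum_expr_unity_root (F : fieldType) (n : nat) (z : F) :
  z ^+ n = 1 -> z != 1 -> \sum_(j < n) z ^+ j = 0.
Proof.
move=> zn z1; apply/eqP.
have /eqP := subrX1 z n; rewrite zn subrr eq_sym mulf_eq0 subr_eq0 (negPf z1).
by [].
Qed.

(** * Dual bases of a subfield *)

Section DualBases.
Variables (k : fieldType) (L : fieldExtType k) (K : {vspace L}).
Hypotheses (K1 : 1 \in K) (K_div : {in K &, forall x y, x / y \in K}).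

(* For a functional lam that does not vanish on K, (x, y) |-> lam (x * y) is
   a nondegenerate form on K because K is a field. *)
Lemma dual_bases : exists (e f : 'I_(\dim K) -> L) (lam : {linear L -> k^o}),
  [/\ forall r, e r \in K, forall r, f r \in K,
      {in K, forall y, \sum_r lam (e r * y) *: f r = y},
      forall a : 'I_(\dim K) -> k, \sum_r a r *: e r = 0 -> forall r, a r = 0 &
      forall a : 'I_(\dim K) -> k, \sum_r a r *: f r = 0 -> forall r, a r = 0].
Proof.
have Kn0 : (0 < \dim K)%N.
  by rewrite lt0n dimv_eq0; apply: contraTneq K1 => ->; rewrite memv0 oner_eq0.
pose e (r : 'I_(\dim K)) := (vbasis K)`_r; pose r0 := Ordinal Kn0.
pose lam : {linear L -> k^o} := coord (vbasis K) r0.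
have eK (r : 'I_(\dim K)) : e r \in K.
  by rewrite vbasis_mem // mem_nth // size_tuple.
have Kfree : free (vbasis K) := basis_free (vbasisP K).
have efree (a : 'I_(\dim K) -> k) :
    \sum_r a r *: e r = 0 -> forall r, a r = 0 by move/freeP: Kfree => /(_ a).
have lam_e : lam (e r0) = 1 
  by rewrite -[LHS]/(coord (vbasis K) r0 (vbasis K)`_r0) coord_free // eqxx.
(* If [x] were nonzero, expanding [e r0 / x] in the basis would give [lam (e r0) = 0] instead of
   1. *)
have nondeg x : x \in K -> (forall s, lam (x * e s) = 0) -> x = 0.
  move=> xK x0; apply/eqP/negPn/negP => xn0.
  have := lam_e; have -> : e r0 = x * (e r0 / x).
    by rewrite mulrC divfK.
  rewrite (coord_vbasis (K_div (eK r0) xK)) mulr_sumr linear_sum big1 => [/eqP|i _].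
    by rewrite eq_sym oner_eq0.
  by rewrite -scalerAr linearZ /= x0 scaler0.
pose M : 'M[k]_(\dim K) := \matrix_(r, s) lam (e r * e s).
have Mu : M \in unitmx.
  rewrite -row_free_unit; apply: inj_row_free => v vM.
  have /efree v0 : \sum_r v 0 r *: e r = 0.
    apply: nondeg => [|s]; first by apply: rpred_sum => r _; apply: rpredZ.
    move/rowP: vM => /(_ s); rewrite !mxE => <-.
    rewrite mulr_suml linear_sum; apply: eq_bigr => r _.
    by rewrite -scalerAl linearZ /= mxE.
  by apply/rowP=> r; rewrite v0 mxE.
(* The inverse Gram matrix turns the values [lam (e r * y)] back into the coordinates of [y]. *)
pose f r := \sum_s invmx M s r *: e s.
have fE (a : 'I_(\dim K) -> k) :
    \sum_r a r *: f r = \sum_s (invmx M *m \col_r a r) s 0 *: e s.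
  under eq_bigr do rewrite scaler_sumr.
  rewrite exchange_big; apply: eq_bigr => s _; rewrite mxE scaler_suml.
  by apply: eq_bigr => r _; rewrite mxE scalerA mulrC.
exists e, f, lam; split=> //.
- by move=> r; apply: rpred_sum => s _; apply: rpredZ.
- move=> y yK; rewrite fE [RHS](coord_vbasis yK); apply: eq_bigr => s _.
  congr (_ *: _).
  have -> : \col_r lam (e r * y) = M *m \col_s coord (vbasis K) s y.
    apply/colP=> r; rewrite !mxE [in LHS](coord_vbasis yK) mulr_sumr linear_sum.
    by apply: eq_bigr => i _; rewrite -scalerAr linearZ /= !mxE [RHS]mulrC.
  by rewrite mulKmx // mxE.
move=> a; rewrite fE => /efree a0 r.
have : M *m (invmx M *m \col_r a r) = 0.
  have -> : invmx M *m \col_r a r = 0 by apply/colP=> s; rewrite a0 mxE.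
  by rewrite mulmx0.
by rewrite mulKVmx // => /colP/(_ r); rewrite !mxE.
Qed.

End DualBases.

(** * The subfield of order [q] and the trace onto it *)

Section FiniteFieldCodes.
Variables (p t m : nat) (F0 : finFieldType) (pcharF : p \in [pchar F0]).
Local Notation F := (pPrimeCharType pcharF).
Local Notation q := (p ^ t)%N.
Hypotheses (m_gt0 : (0 < m)%N) (cardF : #|F0| = (q ^ m)%N).

Let p_pr : prime p. Proof. exact: pcharf_prime pcharF. Qed.

Lemma expf_qm (x : F) : x ^+ (q ^ m) = x.
Proof. by rewrite -cardF; apply: (@expf_card F0). Qed.

Let q_gt1 : (1 < q)%N.
Proof.
have := finNzRing_gt1 F0; rewrite cardF.
by case: (q) => [|[|q']] //; rewrite ?exp1n ?exp0n.
Qed.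

Lemma frobeniusD (s : nat) (x y : F) :
  (x + y) ^+ (q ^ s) = x ^+ (q ^ s) + y ^+ (q ^ s).
Proof.
apply: exprDn_pchar; rewrite -expnM pnatX; apply/orP; left.
by rewrite pnatE // (pcharf_eq pcharF) inE.
Qed.

Lemma frobenius0 (s : nat) : 0 ^+ (q ^ s) = 0 :> F.
Proof. by rewrite expr0n expn_eq0 eqn0Ngt (ltnW q_gt1). Qed.

Lemma frobenius_sum (s : nat) (I : Type) (r : seq I) (P : pred I) (x : I -> F) :
  (\sum_(i <- r | P i) x i) ^+ (q ^ s) = \sum_(i <- r | P i) x i ^+ (q ^ s).
Proof.
exact: (big_morph (fun y : F => y ^+ (q ^ s)) (frobeniusD s) (frobenius0 s)).
Qed.

Lemma expFp_q (a : 'F_p) : a ^+ q = a.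
Proof.
elim: (t) => [|u IHu]; rewrite ?expr1 // expnS mulnC exprM IHu.
by rewrite -[X in a ^+ X](card_Fp p_pr) expf_card.
Qed.

Let frob1 (x : F) : F := x ^+ q - x.
Let frob1_linear : linear frob1.
Proof.
move=> a x y; have := frobeniusD 1 (a *: x) y; rewrite expn1 /frob1 => ->.
by rewrite exprZn expFp_q scalerBr opprD addrACA.
Qed.
HB.instance Definition _ :=
  GRing.isLinear.Build 'F_p F F _ frob1 frob1_linear.

(** Taking the subfield of order [q] as a kernel makes it an ['F_p]-subspace, to which [dual_bases]
    applies. *)
Definition fixedq : {vspace F} := lker (linfun frob1).

Lemma mem_fixedq (x : F) : (x \in fixedq) = (x ^+ q == x).
Proof. by rewrite memv_ker lfunE /= /frob1 subr_eq0. Qed.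

Lemma fixedq_expX (x : F) (s : nat) : x \in fixedq -> x ^+ (q ^ s) = x.
Proof.
rewrite mem_fixedq => /eqP xq; elim: s => [|s IHs]; rewrite ?expr1 //.
by rewrite expnS mulnC exprM IHs.
Qed.

Lemma fixedq1 : 1 \in fixedq.
Proof. by rewrite mem_fixedq expr1n. Qed.

Lemma fixedqM : {in fixedq &, forall x y, x * y \in fixedq}.
Proof. by move=> x y; rewrite !mem_fixedq exprMn => /eqP-> /eqP->. Qed.

Lemma fixedq_div : {in fixedq &, forall x y, x / y \in fixedq}.
Proof. by move=> x y; rewrite !mem_fixedq expr_div_n => /eqP-> /eqP->. Qed.

(** The degree of ['X^q - 'X] gives the upper bound. For the lower one, [q - 1] divides [q ^ m - 1],
    so this polynomial divides ['X^#|F| - 'X], which splits into distinct linear factors over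
    [F]. *)
Lemma card_fixedq : #|fixedq| = q.
Proof.
have Xq_size : size ('X^q - 'X : {poly F}) = q.+1.
  by rewrite size_polyDl ?size_polyXn // size_polyN size_polyX.
have Xq_n0 : ('X^q - 'X : {poly F}) != 0 by rewrite -size_poly_eq0 Xq_size.
have rootXq (x : F) : root ('X^q - 'X) x = (x \in fixedq).
  by rewrite rootE !hornerE mem_fixedq subr_eq0.
apply/eqP; rewrite eqn_leq; apply/andP; split.
  rewrite cardE -ltnS -Xq_size max_poly_roots ?enum_uniq //.
  by apply/allP => x; rewrite mem_enum rootXq.
have Xn_factor k : (0 < k)%N -> 'X^k - 'X = 'X * ('X^(k.-1) - 1) :> {poly F}.
  by move=> k_gt0; rewrite mulrBr mulr1 -exprS prednK.
have: ('X^q - 'X : {poly F}) %| 'X^#|F| - 'X.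
  have [q_gt0 cF] := (ltnW q_gt1, cardF : #|F| = (q ^ m)%N).
  have /dvdnP[d dE] := dvdn_pred_predX q m.
  rewrite cF (Xn_factor q) // Xn_factor ?expn_gt0 ?prime_gt0 //.
  by rewrite dvdp_mul2l ?polyX_eq0 // dE mulnC exprM [X in _ %| X]subrX1 dvdp_mulr.
(* A divisor of a product of linear factors is, up to a unit, a subproduct; [msk] selects its roots,
   and the degree says that there are [q] of them. *)
rewrite finField_genPoly -big_enum => /dvdp_prod_XsubC[msk eqX].
have msk_size : size (mask msk (enum F)) = q.
  by apply/succn_inj; rewrite -Xq_size (eqp_size eqX) size_prod_XsubC.
rewrite -{1}msk_size cardE uniq_leq_size ?mask_uniq ?enum_uniq // => x x_msk.
by rewrite mem_enum -rootXq (eqp_root eqX) root_prod_XsubC.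
Qed.

Lemma dim_fixedq : \dim fixedq = t.
Proof.
apply/eqP; rewrite -(eqn_exp2l _ _ (prime_gt1 p_pr)) -card_fixedq.
by rewrite card_vspace card_Fp.
Qed.

Definition trq (x : F) : F := \sum_(s < m) x ^+ (q ^ s).

Lemma trqB (x y : F) : trq (x - y) = trq x - trq y.
Proof.
rewrite -sumrB; apply: eq_bigr => s _; rewrite frobeniusD; congr (_ + _).
apply/eqP; rewrite -addr_eq0 -frobeniusD addNr frobenius0; exact/eqP.
Qed.

(** Raising to the power [q] permutes the summands cyclically, the last one wrapping round by
    [expf_qm]. *)
Lemma trq_fixed (x : F) : trq x \in fixedq.
Proof.
rewrite mem_fixedq -[q in _ ^+ q]expn1 frobenius_sum expn1; apply/eqP.
rewrite /trq -(prednK m_gt0) [LHS]big_ord_recr [RHS]big_ord_recl /= expr1 [LHS]addrC.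
congr (_ + _); last first.
  by apply: eq_bigr => s _; rewrite -exprM -expnSr.
by rewrite -exprM -expnSr prednK // expf_qm.
Qed.

Lemma trqZ (c x : F) : c \in fixedq -> trq (c * x) = c * trq x.
Proof.
move=> cK; rewrite mulr_sumr; apply: eq_bigr => s _.
by rewrite exprMn (fixedq_expX _ cK).
Qed.

(* The trace polynomial has degree q^(m-1) < #|F|. *)
Lemma trq_neq0 : exists x, trq x != 0.
Proof.
case: (pickP (fun x : F => trq x != 0)) => [x|tr0]; first by exists x.
pose T : {poly F} := \sum_(s < m) 'X^(q ^ s).
have T_size : size T = (q ^ m.-1).+1.
  rewrite /T -(prednK m_gt0) big_ord_recr /= addrC size_polyDl ?size_polyXn //.
  apply: leq_ltn_trans (size_sum _ _ _) _; rewrite ltnS.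
  by apply/bigmax_leqP => s _; rewrite size_polyXn ltn_exp2l.
have T_n0 : T != 0 by rewrite -size_poly_eq0 T_size.
have := @max_poly_roots _ T (enum F) T_n0; rewrite enum_uniq T_size -cardE.
have -> : #|F| = (q ^ m)%N := cardF.
rewrite ltnS leqNgt ltn_exp2l // ltn_predL m_gt0 => h.
suff /h: all (root T) (enum F) by move/(_ isT).
apply/allP=> x _; rewrite rootE horner_sum.
by under eq_bigr do rewrite hornerXn; apply/negbFE/tr0.
Qed.

Lemma trq_surj (y : F) : y \in fixedq -> exists x, trq x = y.
Proof.
move=> yK; have [x tx] := trq_neq0; exists (y / trq x * x).
by rewrite trqZ ?fixedq_div ?trq_fixed // divfK.
Qed.

(** * Syndromes of expanded words and the minimum distance *)

Local Notation n := (q ^ m - 1)%N.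
Variables (alpha : F) (e f : 'I_t -> F) (lam : {linear F -> ('F_p)^o}).
Hypotheses (alphaP : n.-primitive_root alpha).

(** The [t * n] coordinates form a [t] by [n] matrix whose column [j] is read as one [q]-ary symbol.
    The family [g] will be [f] for the kernel code and [e] for words orthogonal to the trace
    code. *)
Definition symb (g : 'I_t -> F) (b : qlabel p (t * n)) (j : 'I_n) : F :=
  \sum_r b (mxvec_index r j) *: g r.

(** For odd [q], taking [eps] to be -1 amounts to shifting every exponent [i] by [n / 2]. *)
Definition syndrome (eps : F) (g : 'I_t -> F) (b : qlabel p (t * n)) (i : nat) : F :=
  \sum_j symb g b j * eps ^+ j * alpha ^+ (i * j).

Lemma symbB g a b j : symb g (a - b) j = symb g a j - symb g b j.
Proof. by rewrite -sumrB; apply: eq_bigr => r _; rewrite !ffunE scalerBl. Qed.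

Lemma syndromeB eps g a b i :
  syndrome eps g (a - b) i = syndrome eps g a i - syndrome eps g b i.
Proof. by rewrite -sumrB; apply: eq_bigr => j _; rewrite symbB !mulrBl. Qed.

Section MinimumDistance.
Variables (eps : F) (g : 'I_t -> F).
Hypotheses (gK : forall r, g r \in fixedq) (epsK : eps \in fixedq) (eps_n0 : eps != 0).

Lemma symb_fixed b j : symb g b j \in fixedq.
Proof. by apply: rpred_sum => r _; apply: rpredZ. Qed.

Let fixedqX s : eps ^+ s \in fixedq.
Proof. by elim: s => [|s IHs]; rewrite ?fixedq1 // exprS fixedqM. Qed.

(** Symbols and powers of [eps] are fixed by the Frobenius map, which therefore only multiplies the
    exponent. A zero at [i] thus gives one at [q * i] at no cost. *)
Lemma syndrome_frobenius b i : syndrome eps g b (q * i) = syndrome eps g b i ^+ q.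
Proof.
rewrite -[q in _ ^+ q]expn1 frobenius_sum; apply: eq_bigr => j _.
rewrite !exprMn (fixedq_expX _ (symb_fixed b j)) (fixedq_expX _ (fixedqX j)).
by rewrite expn1 -exprM mulnC mulnA mulnAC [(j * i)%N]mulnC.
Qed.

Lemma syndrome0_fixed b : syndrome eps g b 0 \in fixedq.
Proof.
by apply: rpred_sum => j _; rewrite mul0n mulr1 fixedqM ?symb_fixed.
Qed.

(** A nonzero symbol has a nonzero coordinate, so expansion over ['F_p] cannot lower the weight. *)
Lemma card_symb_supp b : (#|[set j | symb g b j != 0%R]| <= wt b)%N.
Proof.
pose pos (x : 'I_(t * n)) : 'I_n :=
  (enum_val (cast_ord (esym (mxvec_cast t n)) x)).2.
apply: leq_trans (leq_imset_card pos _).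
apply/subset_leq_card/subsetP => j; rewrite inE => bj.
have [/forallP b0|] := boolP [forall r, b (mxvec_index r j) == 0].
  case/eqP: bj; rewrite /symb big1 // => r _.
  by rewrite (eqP (b0 r)) scale0r.
rewrite negb_forall => /existsP[r br]; apply/imsetP.
exists (mxvec_index r j); first by rewrite inE.
by rewrite /pos /mxvec_index cast_ordK enum_rankK.
Qed.

(** The BCH bound kills the twisted symbols, and independence of [g] then kills their coordinates.
    [R] need only list one exponent of each pair [i], [q * i]. *)
Lemma bch_min_distance (R : seq nat) (s w : nat) b :
  (forall a : 'I_t -> 'F_p, \sum_r a r *: g r = 0 -> forall r, a r = 0) ->
  (forall i, (s <= i < s + w)%N ->
     i \in R \/ exists2 i', i = (q * i')%N & i' \in R) ->
  (wt b <= w)%N -> (forall i, i \in R -> syndrome eps g b i = 0) -> b = 0.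
Proof.
move=> gfree Rcov bw b0.
have sy0 j : symb g b j * eps ^+ j = 0.
  move: j; apply: (@bch_bound _ n alpha _ s w) => //.
    apply: leq_trans bw; apply: leq_trans (card_symb_supp b).
    apply/subset_leq_card/subsetP => j; rewrite !inE.
    by apply: contra => /eqP->; rewrite mul0r.
  move=> i /Rcov[/b0 //|[i' -> /b0 i'0]].
  by rewrite -/(syndrome eps g b _) syndrome_frobenius i'0 -[q]expn1 frobenius0.
apply/ffunP=> x; rewrite ffunE; case/mxvec_indexP: x => r j.
apply: (gfree (fun r => b (mxvec_index r j))); apply/eqP.
by have /eqP := sy0 j; rewrite mulf_eq0 expf_eq0 (negPf eps_n0) andbF orbF.
Qed.

End MinimumDistance.

(** * The kernel code and the trace code: sizes, inclusion, duality *)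

(** Both the range of the syndrome at [i] and the parameter space of the trace term at [i]; exponent
    0 has a one-element cyclotomic coset and gets only the subfield. *)
Definition zdom (i : nat) : pred F := [pred x | (i != 0%N) || (x \in fixedq)].

Definition zcost (R : seq nat) : nat := (\sum_(i <- R) if i == 0 then 1 else m)%N.

Definition zfamily (R : seq nat) : {set {ffun 'I_(size R) -> F}} :=
  [set y : {ffun 'I_(size R) -> F} | [forall l : 'I_(size R), zdom (nth 0%N R l) (y l)]].

Lemma card_zfamily R : #|zfamily R| = (p ^ (t * zcost R))%N.
Proof.
have -> : #|zfamily R| = #|family (fun l : 'I_(size R) => zdom (nth 0%N R l))|.
  by apply: eq_card => y; rewrite inE.
rewrite card_family foldrE big_map big_enum /= /zcost big_distrr expn_sum /=.
rewrite (big_nth 0%N) big_mkord; apply: eq_bigr => l _.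
case: eqP => [l0|/eqP l0].
  rewrite muln1 -card_fixedq; apply: eq_card => x.
  by rewrite !inE l0.
rewrite expnM -cardF; apply: eq_card => x.
by rewrite !inE l0.
Qed.

Definition bch_kernel (eps : F) (R : seq nat) : {set qlabel p (t * n)} :=
  [set a | all (fun i => syndrome eps f a i == 0) R].

Lemma bch_kernel_sub eps R :
  {in bch_kernel eps R &, forall a b, a - b \in bch_kernel eps R}.
Proof.
move=> a b; rewrite !inE => /allP a0 /allP b0; apply/allP=> i iR.
by rewrite syndromeB (eqP (a0 i iR)) (eqP (b0 i iR)) subrr.
Qed.

(** Each fibre of the syndrome map is translated into the kernel, and the image lies in
    [zfamily R]. *)
Lemma card_bch_kernel eps R : eps \in fixedq -> (forall r, f r \in fixedq) ->
  (p ^ (t * n) <= #|bch_kernel eps R| * p ^ (t * zcost R))%N.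
Proof.
move=> epsK fK.
pose syn a : {ffun 'I_(size R) -> F} :=
  [ffun l : 'I_(size R) => syndrome eps f a (nth 0%N R l)].
have -> : (p ^ (t * n))%N = #|[set: qlabel p (t * n)]|.
  by rewrite cardsT card_ffun card_Fp // card_ord.
rewrite -card_zfamily [X in (_ <= X)%N]mulnC.
apply: (@leq_trans (#|syn @: [set: qlabel p (t * n)]| * #|bch_kernel eps R|)).
  apply: card_leq_fibers => _ /imsetP[a _ ->].
  rewrite -(card_imset _ (addIr (- a))).
  apply/subset_leq_card/subsetP => _ /imsetP[x + ->]; rewrite !inE /= => /eqP/ffunP xa; apply/allP=> i iR.
  rewrite syndromeB subr_eq0.
  have lt_i : (index i R < size R)%N by rewrite index_mem.
  by have := xa (Ordinal lt_i); rewrite !ffunE /= nth_index // => ->.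
rewrite leq_mul2r subset_leq_card ?orbT //.
apply/subsetP => _ /imsetP[a _ ->]; rewrite inE; apply/forallP=> l.
by rewrite /zdom /= ffunE; case: eqP => //= ->; apply: syndrome0_fixed.
Qed.

(* The exponent 0 must only contribute a factor #|K|: there the trace, whose
   restriction to K is multiplication by m, is replaced by the identity of K. *)
Definition trace_term (i : nat) (y : F) (j : nat) : F :=
  if i == 0%N then y else trq (y * alpha ^+ (i * j)).

Definition trace_word (R : seq nat) (y : {ffun 'I_(size R) -> F}) (j : 'I_n) : F :=
  \sum_(l < size R) trace_term (nth 0%N R l) (y l) j.

(** When [e] and [f] are dual through [lam], these entries are the coordinates of [x j] along
    [f]. *)
Definition expand (x : 'I_n -> F) : qlabel p (t * n) :=
  [ffun i => mxvec (\matrix_(r, j) (lam (e r * x j) : 'F_p)) 0 i].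

Definition trace_code (R : seq nat) : {set qlabel p (t * n)} :=
  [set expand (trace_word y) | y in zfamily R].

Lemma trace_termB i x y j :
  trace_term i (x - y) j = trace_term i x j - trace_term i y j.
Proof. by rewrite /trace_term; case: eqP => // _; rewrite mulrBl trqB. Qed.

Lemma trace_term_fixed i y j : zdom i y -> trace_term i y j \in fixedq.
Proof. by rewrite /trace_term /zdom /=; case: eqP => //= _ _; apply: trq_fixed. Qed.

Lemma trace_word_fixed R y j : y \in zfamily R -> trace_word y j \in fixedq.
Proof.
rewrite inE => /forallP yR; apply: rpred_sum => l _; exact: trace_term_fixed.
Qed.

Lemma trace_code_sub R : {in trace_code R &, forall a b, a - b \in trace_code R}.
Proof.
move=> _ _ /imsetP[x xR ->] /imsetP[y yR ->]; apply/imsetP; exists (x - y).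
  move: xR yR; rewrite !inE => /forallP xR /forallP yR; apply/forallP => l.
  have := xR l; have := yR l; rewrite /zdom /= !ffunE.
  by case: eqP => //= _ ? ?; apply: rpredB.
apply/ffunP=> i; rewrite !ffunE; case/mxvec_indexP: i => r j; rewrite !mxvecE !mxE.
rewrite -linearB -mulrBr -sumrB; congr (lam (_ * _)); apply: eq_bigr => l _.
by rewrite !ffunE trace_termB.
Qed.

Lemma trace_code0 R : 0 \in trace_code R.
Proof.
suff [x xC] : exists x, x \in trace_code R by rewrite -(subrr x) trace_code_sub.
exists (expand (trace_word (0 : {ffun 'I_(size R) -> F}))); apply: imset_f.
by rewrite inE; apply/forallP => l; rewrite /zdom /= ffunE rpred0 orbT.
Qed.

Lemma card_trace_code R : (#|trace_code R| <= p ^ (t * zcost R))%N.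
Proof. by rewrite -card_zfamily leq_imset_card. Qed.

(** By linearity of [lam], orthogonality over ['F_p] becomes a relation between [q]-ary words, with
    [b] read along [e] while [x] is expanded along [f]. *)
Lemma dot_expand (b : qlabel p (t * n)) (x : 'I_n -> F) :
  \sum_i b i * expand x i = lam (\sum_j symb e b j * x j).
Proof.
rewrite (reindex _ (curry_mxvec_bij t n)) linear_sum.
transitivity (\sum_(j < n) \sum_(r < t)
  b (mxvec_index r j) * (lam (e r * x j) : 'F_p)).
  rewrite exchange_big pair_bigA; apply: eq_bigr => -[r j] _ /=.
  by rewrite ffunE mxvecE mxE.
apply: eq_bigr => j _; rewrite mulr_suml linear_sum; apply: eq_bigr => r _.
by rewrite -scalerAl linearZ.
Qed.

Section DualExpansion.
Hypotheses (eK : forall r, e r \in fixedq).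
Hypothesis ef_dual : {in fixedq, forall y : F, \sum_r lam (e r * y) *: f r = y}.

Lemma symb_expand (x : 'I_n -> F) j : x j \in fixedq -> symb f (expand x) j = x j.
Proof.
move=> xK; rewrite -[RHS]ef_dual //; apply: eq_bigr => r _.
by rewrite ffunE mxvecE mxE.
Qed.

Lemma trace_code_sub_kernel eps R1 R2 : eps ^+ n = 1 ->
  (forall i1 i2 s, i1 \in R1 -> i2 \in R2 -> (s < m)%N ->
     eps * alpha ^+ (i1 + i2 * q ^ s) != 1) ->
  trace_code R2 \subset bch_kernel eps R1.
Proof.
move=> eps_n disj; apply/subsetP => _ /imsetP[y yR ->]; rewrite inE.
apply/allP=> i1 i1R; rewrite /syndrome.
under eq_bigr do rewrite symb_expand ?trace_word_fixed // /trace_word !mulr_suml.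
have geo0 i2 s : i2 \in R2 -> (s < m)%N ->
    \sum_(j < n) eps ^+ j * alpha ^+ ((i1 + i2 * q ^ s) * j) = 0.
  move=> i2R sm.
  under eq_bigr do rewrite exprM -exprMn.
  apply: sum_expr_unity_root; last exact: disj.
  by rewrite exprMn eps_n mul1r -exprM mulnC exprM (prim_expr_order alphaP) expr1n.
rewrite exchange_big big1 //= => l _.
have i2R : nth 0%N R2 l \in R2 by rewrite mem_nth.
(* At exponent 0 there is no trace to expand, and the geometric sum for [s = 0] is enough. *)
rewrite /trace_term; case: eqP => [i20|_].
  have := geo0 _ _ i2R m_gt0; rewrite i20 mul0n addn0 => geo.
  transitivity (y l * \sum_(j < n) eps ^+ j * alpha ^+ (i1 * j)).
    by rewrite mulr_sumr; apply: eq_bigr => j _; rewrite mulrA.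
  by rewrite geo mulr0.
under eq_bigr do rewrite /trq !mulr_suml.
rewrite exchange_big big1 //= => s _.
transitivity (y l ^+ (q ^ s) * \sum_(j < n) eps ^+ j *
    alpha ^+ ((i1 + nth 0%N R2 l * q ^ s) * j)); last by rewrite geo0 ?mulr0.
rewrite mulr_sumr; apply: eq_bigr => j _.
rewrite exprMn -exprM mulnDl exprD mulnAC -!mulrA; congr (_ * _).
by rewrite mulrCA [alpha ^+ _ * alpha ^+ _]mulrC.
Qed.

(* lam (trq (y * S)) = 0 for all y forces S = 0, since the trace is onto K and
   lam does not vanish on K. *)
Lemma trace_code_dual R (b : qlabel p (t * n)) :
  (forall z : qlabel p (t * n), z \in trace_code R -> \sum_i b i * z i = 0) ->
  forall i, i \in R -> syndrome 1 e b i = 0.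
Proof.
move=> bR i iR; apply/eqP/negPn/negP; set S := syndrome 1 e b i => Sn0.
(* If [lam] vanished on all [e r], the duality formula at 1 would read [0 = 1]. *)
have [y yK lam_y] : exists2 y, y \in fixedq & lam y != 0.
  have [/forallP lam0|] := boolP [forall r, lam (e r) == 0].
    have := ef_dual fixedq1; rewrite big1 => [/eqP|r _].
      by rewrite eq_sym oner_eq0.
    by rewrite mulr1 (eqP (lam0 r)) scale0r.
  by rewrite negb_forall => /existsP[r er]; exists (e r).
have lt_i : (index i R < size R)%N by rewrite index_mem.
pose l0 := Ordinal lt_i.
have l0E : nth 0%N R l0 = i by rewrite /= nth_index.
(* Test against the trace word whose only nonzero parameter is [x], placed at exponent [i]. *)
have key x : zdom i x -> lam (\sum_j symb e b j * trace_term i x j) = 0.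
  move=> xi; pose c : {ffun 'I_(size R) -> F} := [ffun l => if l == l0 then x else 0].
  rewrite -(bR (expand (trace_word c))); last first.
    apply: imset_f; rewrite inE; apply/forallP => l; rewrite ffunE.
    have [->|_] := eqVneq l l0; first by rewrite l0E.
    by rewrite /zdom /= rpred0 orbT.
  rewrite dot_expand; congr (lam _); apply: eq_bigr => j _; congr (_ * _).
  rewrite /trace_word (bigD1 l0) //= big1 => [|l ll0]; last first.
    by rewrite ffunE (negPf ll0) -(subrr 0) trace_termB !subrr.
  by rewrite addr0 ffunE eqxx -[index i R]/(nat_of_ord l0) l0E.
case/eqP: lam_y; have [i0|i_n0] := eqVneq i 0%N.
  have SK : S \in fixedq by rewrite /S i0 syndrome0_fixed ?fixedq1.
  rewrite -(key (y / S)); last by rewrite /zdom /= fixedq_div ?orbT.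
  congr (lam _); rewrite /trace_term i0 eqxx -mulr_suml mulrC -[LHS](divfK Sn0).
  congr (_ * _); apply: eq_bigr => j _.
  by rewrite i0 expr1n mul0n !mulr1.
(* The parameter [x / S] makes the pairing equal to [lam (trq x) = lam y], which is nonzero. *)
have [x xy] := trq_surj yK.
rewrite -(key (x / S)); last by rewrite /zdom /= i_n0.
congr (lam _); rewrite /trace_term (negPf i_n0) -xy -{1}[x](divfK Sn0).
rewrite /S /syndrome mulr_sumr /trq.
transitivity (\sum_j trq (symb e b j * (x / S * alpha ^+ (i * j)))).
  rewrite exchange_big; apply: eq_bigr => s _; rewrite frobenius_sum.
  apply: eq_bigr => j _; congr (_ ^+ _).
  by rewrite expr1n mulr1 mulrCA.
by apply: eq_bigr => j _; rewrite trqZ // symb_fixed.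
Qed.

End DualExpansion.

End FiniteFieldCodes.

(** * Divisibility of exponents by [q ^ m - 1], and lists of zeros *)

(** Let [M] be the quotient. For [s < 2] the sum is too small. Otherwise the size bound gives
    [M <= D], and [q ^ s] divides [y1 + M], which is positive and at most [A + D < q ^ 2]. *)
Lemma ndvd_pred_exp (q m s A B D y1 y2 : nat) : (1 < q)%N -> (2 < m)%N ->
  (s < m)%N -> (y1 <= A)%N -> (y2 <= B)%N -> (0 < y1 + y2 * q ^ s)%N ->
  (A + B * q < q ^ 3 - 1)%N -> (A + D < q ^ 2)%N ->
  (A + B * q ^ m.-1 < D.+1 * (q ^ m - 1))%N ->
  ~~ (q ^ m - 1 %| y1 + y2 * q ^ s)%N.
Proof.
move=> q1 m2 sm y1A y2B y_gt0 small AD big; apply/negP => /dvdnP[M yM].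
have qexp a b : (a <= b)%N -> (q ^ a <= q ^ b)%N by rewrite leq_exp2l.
have M_gt0 : (0 < M)%N by case: (M) yM => // y0; move: y_gt0; rewrite y0.
have n_gt0 : (1 < q ^ m)%N by rewrite -(exp1n m) ltn_exp2r //; lia.
have [s2|s1] := leqP 2 s; last first.
  have yle : (y1 + y2 * q ^ s <= A + B * q)%N.
    rewrite leq_add // leq_mul // -[X in (_ <= X)%N]expn1 qexp //.
  have := qexp 3%N m m2; have := leq_pmull (q ^ m - 1) M_gt0; lia.
have MD : (M <= D)%N.
  rewrite -ltnS -(@ltn_pmul2r (q ^ m - 1)) ?subn_gt0 // -yM.
  apply: leq_ltn_trans big; rewrite leq_add // leq_mul // qexp //; lia.
have /dvdn_leq : (q ^ s %| y1 + M)%N.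
  rewrite -(@dvdn_addl (y2 * q ^ s)) ?dvdn_mull //.
  have -> : (y1 + M + y2 * q ^ s = M * q ^ m)%N.
    by rewrite addnAC yM mulnBr muln1 subnK // leq_pmulr // ltnW.
  by rewrite dvdn_mull // dvdn_exp2l // ltnW.
have := qexp 2%N s s2; lia.
Qed.

Lemma ndvd_bch (q m s y1 y2 : nat) : (2 < q)%N -> (2 < m)%N -> (s < m)%N ->
  (y1 <= 2 * q - 2)%N -> (0 < y2 <= 2 * q)%N ->
  ~~ (q ^ m - 1 %| y1 + y2 * q ^ s)%N.
Proof.
move=> q2 m2 sm y1q /andP[y2_gt0 y2q].
have Q : (q ^ 2 <= q ^ m.-1)%N by rewrite leq_exp2l ?(ltnW q2) //; lia.
(* The quotient is at most 2, since [2 * q * q ^ m.-1] is [2 * q ^ m]. *)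
apply: (@ndvd_pred_exp _ _ _ (2 * q - 2) (2 * q) 2) => //.
- by lia.
- by rewrite addn_gt0 muln_gt0 y2_gt0 expn_gt0 (ltn_trans _ q2) // orbT.
- by rewrite !expnS expn0; nia.
- by rewrite !expnS expn0; nia.
- rewrite -{2}(ltn_predK m2) expnS; nia.
Qed.

Lemma ndvd_twisted_small (q m s y1 y2 : nat) : (2 < q)%N -> (2 < m)%N ->
  (s < m)%N -> (y1 <= q - 2)%N -> (y2 <= q - 2)%N ->
  (0 < y1 + y2 * q ^ s)%N -> ~~ (q ^ m - 1 %| (y1 + y2 * q ^ s).*2)%N.
Proof.
move=> q2 m2 sm y1q y2q y_gt0.
have Q : (q ^ 2 <= q ^ m.-1)%N by rewrite leq_exp2l ?(ltnW q2) //; lia.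
rewrite doubleD doubleMl.
apply: (@ndvd_pred_exp _ _ _ (2 * q - 4) (2 * q - 4) 1) => //.
- by lia.
- by lia.
- by lia.
- by rewrite -doubleMl -doubleD double_gt0.
- by rewrite !expnS expn0; nia.
- by rewrite !expnS expn0; nia.
- rewrite -{2}(ltn_predK m2) expnS; nia.
Qed.

Lemma ndvd_twisted (q m s y1 y2 : nat) : (3 < q)%N -> (2 < m)%N ->
  (s < m)%N -> (y1 <= 2 * q - 2)%N -> (y2 <= 2 * q - 2)%N ->
  (0 < y1 + y2 * q ^ s)%N -> ~~ (q ^ m - 1 %| (y1 + y2 * q ^ s).*2)%N.
Proof.
move=> q3 m2 sm y1q y2q y_gt0.
have Q : (q ^ 2 <= q ^ m.-1)%N by rewrite leq_exp2l ?(ltnW (ltnW q3)) //; lia.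
rewrite doubleD doubleMl.
(* Doubling allows quotients up to 3; the condition [4 * q - 1 < q ^ 2] is where [q > 3] enters. *)
apply: (@ndvd_pred_exp _ _ _ (4 * q - 4) (4 * q - 4) 3) => //.
- by lia.
- by lia.
- by lia.
- by rewrite -doubleMl -doubleD double_gt0.
- by rewrite !expnS expn0; nia.
- by rewrite !expnS expn0; nia.
- rewrite -{2}(ltn_predK m2) expnS; nia.
Qed.

(** The factor [4 * q - 5] is the largest that multiplies [m] in the five dimension formulas, so all
    these dimensions are nonnegative. *)
Lemma bch_length_bound (q m : nat) : (2 < q)%N -> (2 < m)%N ->
  (m * (4 * q - 5) + 2 <= q ^ m - 1)%N.
Proof.
move=> q2; elim: m => // m IHm; rewrite ltnS leq_eqVlt => /predU1P[<-|m2].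
  by rewrite !expnS expn0; nia.
have := IHm m2; rewrite expnS; nia.
Qed.

(* Every i in [1, M] is in the list or is q times an element of it when
   M < q^2, so that i and i / q have conjugate syndromes. *)
Definition zlist (q : nat) (z : bool) (M : nat) : seq nat :=
  nseq z 0%N ++ [seq i <- iota 1 M | ~~ (q %| i)%N].

Lemma mem_zlist (q : nat) (z : bool) (M i : nat) :
  (i \in zlist q z M) = (z && (i == 0%N)) || (0 < i <= M)%N && ~~ (q %| i)%N.
Proof.
rewrite mem_cat mem_nseq mem_filter mem_iota add1n ltnS [X in _ || X]andbC.
by case: z.
Qed.

(** The run of zeros starts at 0 if [z] holds and at 1 otherwise. As [M < q * q], one division by
    [q] reaches an exponent that [q] does not divide. *)
Lemma zlist_cover (q : nat) (z : bool) (M w i : nat) :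
  (1 < q)%N -> (M < q * q)%N -> (w <= M + z)%N ->
  (~~ z <= i < ~~ z + w)%N ->
  i \in zlist q z M \/ exists2 i', i = (q * i')%N & i' \in zlist q z M.
Proof.
move=> q1 Mq wM iw; case: (posnP i) => [i0|i_gt0].
  by left; rewrite mem_zlist i0 eqxx; move: iw; rewrite i0; case: z wM.
have iM : (i <= M)%N by case: z wM iw; lia.
have [/dvdnP[i' iE]|qi] := boolP (q %| i)%N; last first.
  by left; rewrite mem_zlist i_gt0 iM qi orbT.
right; exists i'; first by rewrite mulnC.
have i'_gt0 : (0 < i')%N by case: (i') iE i_gt0 => // ->.
have i'q : (i' < q)%N by nia.
rewrite mem_zlist i'_gt0 /=; apply/orP; right; apply/andP; split; first nia.
by apply/negP => /(dvdn_leq i'_gt0); rewrite leqNgt i'q.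
Qed.

Lemma size_zlist (q : nat) (z : bool) (M : nat) :
  (0 < q)%N -> size (zlist q z M) = (z + (M - M %/ q))%N.
Proof.
move=> q_gt0; rewrite size_cat size_nseq size_filter; congr (_ + _)%N.
elim: M => [|M IHM]; first by rewrite div0n.
have := leq_div M q.
by rewrite -{1}(addn1 M) iotaD count_cat IHM /= add1n addn0 divnS //;
  case: (q %| _)%N; lia.
Qed.
Lemma zcost_zlist (m q : nat) (z : bool) (M : nat) : (0 < q)%N ->
  zcost m (zlist q z M) = (z + m * (M - M %/ q))%N.
Proof.
move=> q_gt0; rewrite /zcost big_cat /=; congr (_ + _)%N.
  by case: z; rewrite ?big_seq1 ?big_nil.
have /addnI <- : (false + size [seq i <- iota 1 M | ~~ (q %| i)] =
    false + (M - M %/ q))%N by rewrite -(size_zlist false).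
rewrite big_seq (eq_bigr (fun=> m)) => [|i]; last first.
  by rewrite mem_filter mem_iota => /and3P[_]; case: i.
by rewrite -big_seq big_const_seq count_predT iter_addn_0.
Qed.

(** * Quantum codes from prescribed zeros *)

Lemma exists_prim_root (F : finFieldType) : exists z : F, #|F|.-1.-primitive_root z.
Proof.
have F_gt1 := finNzRing_gt1 F.
have nz x : x != 0 -> x ^+ #|F|.-1 = 1 :> F.
  move=> x0; apply: (mulfI x0); rewrite -exprS (ltn_predK F_gt1) mulr1.
  exact: expf_card.
have /hasP[z _ zP] : has #|F|.-1.-primitive_root (enum (predC1 (0 : F))).
  apply: has_prim_root; rewrite ?enum_uniq //.
  - by rewrite -ltnS (ltn_predK F_gt1).
  - by apply/allP => x; rewrite mem_enum inE => /nz; rewrite unity_rootE => ->.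
  - by rewrite -cardE cardC1.
by exists z.
Qed.

(** The flags [z1], [z2] add exponent 0 to the zeros [1..M1] against flips and [1..M2] against phase
    shifts. [twist] sets [eps] to -1, which permits 0 on both sides. *)
Lemma AQECC_bch (p t m : nat) (twist z1 z2 : bool) (M1 M2 k az ax : nat) :
  let q := (p ^ t)%N in let n := (q ^ m - 1)%N in
  prime p -> odd p -> (0 < t)%N -> (0 < m)%N ->
  (M1 < q * q)%N -> (M2 < q * q)%N ->
  ((ax.-1)./2.*2 <= M1 + z1)%N -> ((az.-1)./2.*2 <= M2 + z2)%N ->
  (forall i1 i2 s, (i1 <= M1)%N -> (i2 <= M2)%N -> z1 || (0 < i1)%N ->
     z2 || (0 < i2)%N -> (s < m)%N -> let x := (i1 + i2 * q ^ s)%N in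
     if twist then (x == 0%N) || ~~ (n %| x.*2)%N else ~~ (n %| x)%N) ->
  (k + t * (z1 + m * (M1 - M1 %/ q) + (z2 + m * (M2 - M2 %/ q))) <= t * n)%N ->
  AQECC p (t * n) k az ax.
Proof.
move=> q n p_pr p_odd t_gt0 m_gt0 M1q M2q ax1 az2 disj kn.
have p_gt2 : (2 < p)%N by apply: odd_prime_gt2.
have q_gt1 : (1 < q)%N by rewrite -(exp1n t) ltn_exp2r // prime_gt1.
have tm_gt0 : (0 < t * m)%N by rewrite muln_gt0 t_gt0.
have [F0 pcharF cardF0] := pPrimePowerField p_pr tm_gt0.
have cardF : #|F0| = (q ^ m)%N by rewrite cardF0 expnM.
have [alpha0] := exists_prim_root F0; rewrite cardF -subn1 => alphaP.
pose alpha : pPrimeCharType pcharF := alpha0.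
pose eps : pPrimeCharType pcharF := (-1) ^+ twist.
have epsK : eps \in fixedq t pcharF.
  rewrite mem_fixedq -exprM mulnC exprM -signr_odd oddX p_odd orbT.
  by rewrite expr1.
(* The length [n] is even because [p] is odd. *)
have eps_n : eps ^+ n = 1.
  rewrite -exprM mulnC exprM -signr_odd oddB ?expn_gt0 ?prime_gt0 //.
  by rewrite !oddX p_odd !orbT expr0 expr1n.
have eps_n0 : eps != 0 by rewrite signr_eq0.
have := dual_bases (fixedq1 t pcharF) (@fixedq_div p t F0 pcharF).
rewrite (dim_fixedq pcharF m_gt0 cardF) => -[e [f [lam [eK fK ef_dual efree ffree]]]].
pose R1 := zlist q z1 M1; pose R2 := zlist q z2 M2.
have zR (z : bool) M i : i \in zlist q z M -> z || (0 < i)%N /\ (i <= M)%N.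
  by rewrite mem_zlist => /orP[/andP[-> /eqP->]|/andP[/andP[-> ->] _]] //; rewrite orbT.
apply: (@AQECC_css p (t * n) k (bch_kernel m alpha f eps R1)
  (trace_code m alpha e lam R2)) => //.
- exact: bch_kernel_sub.
- exact: trace_code0.
- exact: trace_code_sub.
- apply: trace_code_sub_kernel => // i1 i2 s /zR[i10 i1M] /zR[i20 i2M] sm.
  have := disj i1 i2 s i1M i2M i10 i20 sm; rewrite /eps.
  set x := (i1 + _)%N; case: (twist) => /=; last first.
    by rewrite expr0 mul1r (prim_order_dvd alphaP).
  (* Here [alpha ^+ x = -1]. Squaring gives [n %| x.*2], and [x = 0] would give [1 = -1], impossible
     in odd characteristic. *)
  rewrite expr1 mulN1r eqr_oppLR => xn; apply/negP => /eqP ax1'.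
  case/orP: xn => [/eqP x0|/negP[]]; last first.
    by rewrite (prim_order_dvd alphaP) -muln2 exprM ax1' sqrrN expr1n.
  have /eqP : 2%:R = 0 :> F0.
    by move/eqP: ax1'; rewrite x0 expr0 -addr_eq0 => /eqP.
  by rewrite -(dvdn_pcharf pcharF) => /(dvdn_leq (ltn0Sn 1)); rewrite leqNgt p_gt2.
(* Multiplying by [p ^ (t * c1)] lets the lower bound on the kernel and the upper bound on the trace
   code combine. *)
- have p_gt0 := prime_gt0 p_pr.
  have := card_bch_kernel m_gt0 cardF alpha R1 epsK fK.
  have := card_trace_code m_gt0 cardF alpha e lam R2.
  rewrite !zcost_zlist ?(ltnW q_gt1) //.
  set c1 := (z1 + _)%N; set c2 := (z2 + _)%N => C2_le C1_ge.
  have P1_gt0 : (0 < p ^ (t * c1))%N by rewrite expn_gt0 p_gt0.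
  rewrite -(leq_pmul2r P1_gt0); apply: leq_trans C1_ge.
  apply: (@leq_trans (p ^ (t * c2) * p ^ k * p ^ (t * c1))%N).
    by rewrite !leq_mul2r C2_le !orbT.
  rewrite -!expnD leq_exp2l ?prime_gt1 //.
  by apply: leq_trans kn; rewrite addnAC -mulnDr addnC [(c2 + _)%N]addnC.
- move=> a; rewrite inE => /allP a0 wa.
  apply: (bch_min_distance (R := R1) (s := ~~ z1) m_gt0 cardF alphaP fK epsK
    eps_n0 ffree _ wa) => [i|i iR]; first exact: zlist_cover.
  exact/eqP/a0.
move=> b wb bC.
apply: (bch_min_distance (R := R2) (s := ~~ z2) m_gt0 cardF alphaP eK
  (fixedq1 t pcharF) (oner_neq0 _) efree _ wb) => [i|i iR]; first exact: zlist_cover.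
exact: (trace_code_dual m_gt0 cardF eK ef_dual bC).
Qed.

Theorem theorem12 (p t q m : nat) :
  prime p -> odd p -> (1 <= t)%N -> q = (p ^ t)%N ->
  (3 <= m)%N -> (q = 3%N -> (4 <= m)%N) ->
  let n := (q ^ m - 1)%N in
  (* (1) *)
  (exists k : nat,
     (k%:Z = t%:Z * (n%:Z - m%:Z * (4 * q%:Z - 5) - 2))%R /\
     AQECC p (t * n) k (2 * q + 2) (2 * q)) /\
  (* (2) *)
  (forall c : nat, (c <= q - 2)%N ->
     exists k : nat,
       (k%:Z = t%:Z * (n%:Z - m%:Z * (4 * q%:Z - c%:Z - 5) - 2))%R /\
       AQECC p (t * n) k (2 * q + 2) (2 * q - c)) /\
  (* (3) *)
  (forall c l : nat, (2 <= c <= q)%N -> (l <= c - 2)%N ->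
     exists k : nat,
       (k%:Z = t%:Z * (n%:Z - m%:Z * (2 * c%:Z - l%:Z - 4) - 2))%R /\
       AQECC p (t * n) k c (c - l)) /\
  (* (4) *)
  (forall c l : nat, (q + 2 < c <= 2 * q)%N -> (l <= c - q - 3)%N ->
     exists k : nat,
       (k%:Z = t%:Z * (n%:Z - m%:Z * (2 * c%:Z - l%:Z - 6) - 2))%R /\
       AQECC p (t * n) k c (c - l)) /\
  (* (5) *)
  (forall l : nat, (l <= q - 2)%N ->
     exists k : nat,
       (k%:Z = t%:Z * (n%:Z - m%:Z * (4 * q%:Z - l%:Z - 5) - 1))%R /\
       AQECC p (t * n) k (2 * q + 1) (2 * q - l)).
Proof.
move=> p_pr p_odd t_gt0 qE m_gt2 _ n.
have q_gt2 : (2 < q)%N.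
  apply: (leq_trans (odd_prime_gt2 p_odd p_pr)).
  by rewrite qE -{1}(expn1 p) leq_exp2l ?prime_gt1.
have m_gt0 : (0 < m)%N by lia.
have n_ge : (m * (4 * q - 5) + 2 <= n)%N by apply: bch_length_bound.
have floor2 d : ((d.-1)./2.*2 <= d.-1)%N.
  by rewrite -{2}(odd_double_half d.-1) leq_addl.
have div0 M : (M < q)%N -> (M %/ q)%N = 0%N by apply: divn_small.
have div1 M : (q <= M < 2 * q)%N -> (M %/ q)%N = 1%N.
  move=> /andP[qM M2q]; rewrite -(subnKC qM) divnDl ?dvdnn // divnn div0; lia.
have div2 : (2 * q %/ q)%N = 2%N by rewrite mulnK //; lia.
have qq : (2 * q < q * q)%N by rewrite ltn_mul2r q_gt2 andbT; lia.
have dim_eq x y : (x <= 4 * q - 5)%N -> (y <= 2)%N ->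
    exists k : nat, (k + t * (m * x + y) = t * n)%N /\
    (k%:Z = t%:Z * (n%:Z - m%:Z * x%:Z - y%:Z))%R.
  move=> xq y2; have xn : (m * x + y <= n)%N.
    by apply: leq_trans n_ge; rewrite leq_add // leq_mul2l xq orbT.
  exists (t * (n - (m * x + y)))%N.
  by rewrite -mulnDr subnK // PoszM -subzn // PoszD PoszM opprD addrA.
have cost (z1 z2 : bool) x x1 x2 y k : (k + t * (m * x + y) = t * n)%N ->
    (x1 + x2 = x)%N -> (z1 + z2 <= y)%N ->
    (k + t * (z1 + m * x1 + (z2 + m * x2)) <= t * n)%N.
  move=> <- <- zy; rewrite leq_add2l leq_mul2l addnACA -mulnDr addnC.
  by rewrite leq_add2l zy orbT.
(* Common to (1), (2) and (5): flip zeros [0..2q-c-2], phase zeros [1..2q]. Only one side uses 0, so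
   no twist occurs and the exponent 0 costs 1, within [y]. *)
have narrow az c y : (((az.-1)./2).*2 <= 2 * q)%N -> (c <= q - 2)%N ->
    (0 < y <= 2)%N ->
    exists k : nat,
      (k%:Z = t%:Z * (n%:Z - m%:Z * (4 * q%:Z - c%:Z - 5) - y%:Z))%R /\
      AQECC p (t * n) k az (2 * q - c).
  move=> azq cq /andP[y_gt0 y2].
  have [||k [kn kE]] := @dim_eq (4 * q - c - 5)%N y; [lia | lia |].
  exists k; split.
    by rewrite kE; congr (_ * (_ - _ * _ - _)); lia.
  rewrite /n qE.
  apply: (@AQECC_bch p t m false true false (2 * q - c - 2) (2 * q)) => //;
    rewrite -?qE ?addn0 //.
  - by lia.
  - by have := floor2 (2 * q - c)%N; lia.
  - move=> i1 i2 s i1M i2M _ i20 sm /=.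
    by apply: ndvd_bch => //; lia.
  (* Dropping [q] from the first range and [q], [2q] from the second leaves
     [(2q-c-3) + (2q-2) = 4q-c-5] zeros. *)
  by apply: (cost true false _ _ _ _ _ kn) => //; rewrite div1 ?div2; lia.
split.
  have [|||k [kE kA]] := @narrow (2 * q + 2)%N 0%N 2%N; [lia | lia | by [] |].
  by exists k; move: kE kA; rewrite subr0 subn0.
split; first by move=> c cq; apply: (@narrow _ _ 2%N) => //; lia.
split.
  move=> c l cq lc.
  have [||k [kn kE]] := @dim_eq (2 * c - l - 4)%N 2%N; [lia | lia |].
  exists k; split; first by rewrite kE; congr (_ * (_ - _ * _ - _)); lia.
  rewrite /n qE.
  (* Both sides use exponent 0, hence the twist; the ranges stop below [q], so no multiple of [q] is
     dropped. *)
  apply: (@AQECC_bch p t m true true true (c - l - 2) (c - 2)) => //;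
    rewrite -?qE //.
  - by lia.
  - by lia.
  - by have := floor2 (c - l)%N; lia.
  - by have := floor2 c; lia.
  - move=> i1 i2 s i1M i2M _ _ sm /=; rewrite -implyNb; apply/implyP => x0.
    by apply: ndvd_twisted_small => //; lia.
  by apply: (cost true true _ _ _ _ _ kn) => //; rewrite !div0; lia.
split; last first.
  by move=> l lq; apply: (@narrow _ _ 1%N) => //; lia.
move=> c l cq lc.
have [||k [kn kE]] := @dim_eq (2 * c - l - 6)%N 2%N; [lia | lia |].
exists k; split; first by rewrite kE; congr (_ * (_ - _ * _ - _)); lia.
rewrite /n qE.
(* For q = 3 the twisted zeros can collide (4 + 9 * 4 = (3^4 - 1) / 2), but
   then c = 6 is even and the zeros 1, ..., c - 2 suffice. *)
have [q3|q_neq3] := eqVneq q 3%N.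
  have [cE lE] : c = 6%N /\ l = 0%N by lia.
  subst c l.
  apply: (@AQECC_bch p t m false false false 4 4) => //; rewrite -?qE ?q3 //.
    move=> i1 i2 s i1M i2M _ i20 sm /=.
    by rewrite -q3; apply: ndvd_bch => //; lia.
  by rewrite -q3; apply: (cost false false _ _ _ _ _ kn); rewrite ?q3.
(* Both ranges end strictly between [q] and [2q], so each drops the single exponent [q], which turns
   [2c-l-4] into [2c-l-6]. *)
apply: (@AQECC_bch p t m true true true (c - l - 2) (c - 2)) => //;
  rewrite -?qE //.
- by lia.
- by lia.
- by have := floor2 (c - l)%N; lia.
- by have := floor2 c; lia.
- move=> i1 i2 s i1M i2M _ _ sm /=; rewrite -implyNb; apply/implyP => x0.
  by apply: ndvd_twisted => //; lia.
by apply: (cost true true _ _ _ _ _ kn) => //; rewrite !div1; lia.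
Qed.
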